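(* Let $P$ and $Q$ be bounded orders and let $\psi\colon P\to Q$ be an isotone $\{0,1\}$-map. Then there exist bounded lattices $K$ and $L$ and a $\{0,1\}$-homomorphism $\varphi\colon K\to L$ such that $P$, $Q$, $\psi$ are represented, up to isomorphism, by $\mathrm{Princ}\,K$, $\mathrm{Princ}\,L$, $\varphi_{\mathrm{Hom}}$; that is, there exist order isomorphisms $\mu\colon P\to \mathrm{Princ}\,K$ and $\nu\colon Q\to\mathrm{Princ}\,L$ with $\nu\circ\psi=\varphi_{\mathrm{Hom}}\circ\mu$.
   Context: An order is a partially ordered set; it is bounded if it has a least element $0$ and a greatest element $1$. A bounded lattice is a lattice with a least element $0$ and a greatest element $1$. An isotone map is an order-preserving map ($x\le y$ implies $\psi(x)\le\psi(y)$); a $\{0,1\}$-map between bounded orders is a map sending $0$ to $0$ and $1$ to $1$; a $\{0,1\}$-homomorphism of bounded lattices is a lattice homomorphism sending $0$ to $0$ and $1$ to $1$. No injectivity or surjectivity is assumed. For a lattice $L$ and $a\le b$ in $L$, $\mathrm{con}_L(a,b)$ denotes the principal congruence generated by $(a,b)$, i.e. the smallest lattice congruence of $L$ collapsing $a$ and $b$. For a bounded lattice $L$, $\mathrm{Princ}\,L$ is the set of all principal congruences of $L$ ordered by inclusion; it is a bounded order with least element $\mathrm{con}_L(0,0)$ (the equality relation) and greatest element $\mathrm{con}_L(0,1)$. For a $\{0,1\}$-homomorphism $\varphi\colon K\to L$ of bounded lattices, $\varphi_{\mathrm{Hom}}\colon\mathrm{Princ}\,K\to\mathrm{Princ}\,L$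 is the (well-defined) isotone $\{0,1\}$-map given by $\mathrm{con}_K(a,b)\mapsto\mathrm{con}_L(\varphi(a),\varphi(b))$ for $a\le b$ in $K$. *)

(* Defs.v *)
From HB Require Import structures.
From mathcomp Require Import all_boot all_order.
From mathcomp Require Import boolp classical_sets.

Set Implicit Arguments.
Unset Strict Implicit.
Unset Printing Implicit Defensive.

Import Order.TTheory.

Local Open Scope classical_set_scope.
Local Open Scope order_scope.

Section Congruence.
Context {d : Order.disp_t} {L : latticeType d}.

Record lattice_congruence (R : set (L * L)) : Prop := LatticeCongruence {
  congr_refl : forall x, R (x, x) ;
  congr_sym : forall x y, R (x, y) -> R (y, x) ;
  congr_trans : forall x y z, R (x, y) -> R (y, z) -> R (x, z) ;
  congr_meet : forall x x' y y',
    R (x, x') -> R (y, y') -> R (x `&` y, x' `&` y') ;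
  congr_join : forall x x' y y',
    R (x, x') -> R (y, y') -> R (x `|` y, x' `|` y') }.

Definition con (a b : L) : set (L * L) :=
  smallest lattice_congruence [set (a, b)].

Lemma con_congruence a b : lattice_congruence (con a b).
Proof.
split.
- by move=> x R [cR _]; exact: congr_refl.
- by move=> x y xy R /[dup] [[cR _]] /xy; exact: congr_sym.
- by move=> x y z xy yz R hR; apply: (congr_trans hR.1 (xy R hR) (yz R hR)).
- by move=> x x' y y' xx yy R hR; apply: (congr_meet hR.1 (xx R hR) (yy R hR)).
- by move=> x x' y y' xx yy R hR; apply: (congr_join hR.1 (xx R hR) (yy R hR)).
Qed.

Lemma con_gen a b : con a b (a, b).
Proof. by move=> R [_]; apply. Qed.

Lemma con_min a b (R : set (L * L)) :
  lattice_congruence R -> R (a, b) -> (con a b `<=` R)%classic.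
Proof. by move=> cR Rab; apply: smallest_sub => // _ ->. Qed.

Definition principal_congruence : set (set (L * L)) :=
  [set R | exists a b, a <= b /\ R = con a b].

End Congruence.

Arguments con_gen {d L} a b.
Arguments principal_congruence {d} L.

Record Princ {d : Order.disp_t} (L : latticeType d) := MkPrinc {
  princ_val :> set (L * L) ;
  princ_valP : princ_val \in principal_congruence L }.

Fact Princ_display : Order.disp_t. Proof. exact: Order.Disp tt tt. Qed.

Section PrincOrder.
Context {d : Order.disp_t} (L : latticeType d).

HB.instance Definition _ := [isSub for @princ_val d L].
HB.instance Definition _ := [Choice of Princ L by <:].
HB.instance Definition _ :=
  [SubChoice_isSubPOrder of Princ L by <: with Princ_display].

Lemma Princ_leE (x y : Princ L) :
  (x <= y) = `[< (x `<=` y)%classic >].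
Proof. by []. Qed.

Lemma Princ_gen (x : Princ L) : exists ab : L * L,
  ab.1 <= ab.2 /\ x = con ab.1 ab.2 :> set _.
Proof. by have /set_mem[a [b ?]] := valP x; exists (a, b). Qed.

Definition to_Princ (a b : L) (ab : a <= b) : Princ L :=
  MkPrinc (mem_set (ex_intro _ a (ex_intro _ b (conj ab erefl)))
    : con a b \in principal_congruence L).

Lemma val_to_Princ (a b : L) (ab : a <= b) : princ_val (to_Princ ab) = con a b.
Proof. by []. Qed.

End PrincOrder.

Section PrincBounded.
Context {d : Order.disp_t} (L : tbLatticeType d).

Definition Princ0 : Princ L := to_Princ (lexx (\bot : L)).
Definition Princ1 : Princ L := to_Princ (le0x (\top : L)).

Lemma Princ0E : princ_val Princ0 = [set xy | xy.1 = xy.2].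
Proof.
apply/seteqP; split=> [|[x y] /= ->]; last exact: congr_refl (con_congruence _ _) _.
apply: con_min => //; split=> //=.
- by move=> x y z ->.
- by move=> ? ? ? ? -> ->.
- by move=> ? ? ? ? -> ->.
Qed.

Lemma Princ0_le (x : Princ L) : Princ0 <= x.
Proof.
rewrite Princ_leE; apply/asboolP; rewrite Princ0E => -[y z] /= ->.
have [[a b] [_ ->]] := Princ_gen x.
exact: congr_refl (con_congruence _ _) _.
Qed.

Lemma Princ1_ge (x : Princ L) : x <= Princ1.
Proof.
rewrite Princ_leE; apply/asboolP => -[y z] _; rewrite val_to_Princ.
have c01 := con_congruence (\bot : L) \top.
have con0 t : con (\bot : L) \top (\bot, t).
  have := congr_meet c01 (con_gen _ _) (congr_refl c01 t).
  by rewrite meet0x meet1x.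
exact: (congr_trans c01 (congr_sym c01 (con0 y)) (con0 z)).
Qed.

HB.instance Definition _ :=
  Order.hasBottom.Build Princ_display (Princ L) Princ0_le.
HB.instance Definition _ :=
  Order.hasTop.Build Princ_display (Princ L) Princ1_ge.

End PrincBounded.

Section PrincHom.
Context {dK dL : Order.disp_t} {K : latticeType dK} {L : latticeType dL}.
Variable phi : {lmorphism K -> L}.

Lemma con_hom_le (a b a' b' : K) : (con a b `<=` con a' b')%classic ->
  (con (phi a) (phi b) `<=` con (phi a') (phi b'))%classic.
Proof.
move=> le_ab; have cL := con_congruence (phi a') (phi b').
apply: con_min => //.
pose R : set (K * K) := [set xy | con (phi a') (phi b') (phi xy.1, phi xy.2)].
suff cR : lattice_congruence R.
  exact: (con_min cR (con_gen _ _ : R (a', b')) (le_ab _ (con_gen a b))).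
split; rewrite /R /=.
- by move=> x; exact: (congr_refl cL).
- by move=> x y; exact: (congr_sym cL).
- by move=> x y z; exact: (congr_trans cL).
- by move=> x x' y y' xx yy; rewrite !omorphI; exact: (congr_meet cL).
- by move=> x x' y y' xx yy; rewrite !omorphU; exact: (congr_join cL).
Qed.

(* The map con a b |-> con (phi a) (phi b), via a chosen pair of generators;
   [Princ_homE] shows that the choice is irrelevant. *)
Definition Princ_hom (x : Princ K) : Princ L :=
  let g := cid (Princ_gen x) in
  to_Princ (omorph_le phi (proj1 (svalP g))).

Lemma Princ_homE (a b : K) (ab : a <= b) :
  Princ_hom (to_Princ ab) = to_Princ (omorph_le phi ab).
Proof.
apply: val_inj; rewrite /Princ_hom; case: cid => -[a' b'] /= [ab' e].
by apply/seteqP; split; apply: con_hom_le; rewrite -e.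
Qed.

Lemma Princ_hom_le : {homo Princ_hom : x y / x <= y}.
Proof.
move=> x y; rewrite !Princ_leE => /asboolP xy; apply/asboolP.
rewrite /Princ_hom; case: cid => -[a b] /= [ab ex].
case: cid => -[a' b'] /= [ab' ey].
by apply: con_hom_le; rewrite -ex -ey.
Qed.

End PrincHom.

Definition order_isomorphism {d d' : Order.disp_t} {P : porderType d}
    {Q : porderType d'} (f : P -> Q) : Prop :=
  bijective f /\ {mono f : x y / x <= y}.

(* Main.v *)
From HB Require Import structures.
Require Import Defs.
From mathcomp Require Import all_boot all_order.
From mathcomp Require Import boolp classical_sets cardinality.

Set Implicit Arguments.
Unset Strict Implicit.
Unset Printing Implicit Defensive.

Import Order.TTheory.

(** Each index [i] of color [c i] in the given order [Q] contributes a floating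
    edge [a_i <= b_i], degenerate when [c i = 0], whose congruence is to be
    the one representing [c i].  The elements [a_i], [a_j] have a proper join
    only if [i] and [j] are linked.  A link from [i] to [j] forces
    [b_i <= a_i v b_j], so that collapsing [a_j, b_j] collapses [a_i, b_i],
    but not conversely.  A proper element is thus a finite set of pairwise
    linked indices (its support), with the indices whose upper end it
    contains.  Two comparable elements with different supports generate the
    full congruence, because isolated atoms join to [1] with everything else;
    if the supports agree, the differing indices have pairwise comparable
    colors, and the largest one gives the congruence.  Congruences are bounded
    from above by making more edges degenerate: the edges of color [<= q]
    become degenerate in a quotient, whose kernel is the congruence of [q].

    [K] is built from the indices [P]; [L] from [P] and [Q], with [p] linked
    both ways to [psi p].  The same kind of map as for the quotients embeds
    the indices of [K] and degenerates the edges with [psi p = 0]. *)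

Local Open Scope classical_set_scope.
Local Open Scope order_scope.

(** * Lattices of closed sets *)

Definition moore_family (T : Type) (C : set (set T)) :=
  forall F, (F `<=` C)%classic -> C (\bigcap_(X in F) X).

Record moore (T : Type) (C : set (set T)) (hC : moore_family C) := Moore {
  moore_val :> set T ;
  moore_valP : moore_val \in C }.

Fact moore_display : Order.disp_t. Proof. exact: Order.Disp tt tt. Qed.

Section MooreLattice.
Context {T : Type} {C : set (set T)} (hC : moore_family C).

HB.instance Definition _ := [isSub for @moore_val T C hC].
HB.instance Definition _ := [Choice of moore hC by <:].
HB.instance Definition _ :=
  [SubChoice_isSubPOrder of moore hC by <: with moore_display].

Implicit Types X Y V : moore hC.

Lemma mooreP X : C X.
Proof. exact: set_mem (moore_valP X). Qed.

Lemma moore_leP X Y : reflect (X `<=` Y)%classic (X <= Y).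
Proof. exact: asboolP. Qed.

Lemma moore_eq X Y : X = Y :> set T -> X = Y.
Proof. exact: val_inj. Qed.

Lemma closure_subproof (A : set T) : smallest C A \in C.
Proof. by apply/mem_set/hC => X []. Qed.

Definition closure (A : set T) : moore hC := Moore hC (closure_subproof A).

Lemma sub_closure A : (A `<=` closure A)%classic.
Proof. exact: sub_gen_smallest. Qed.

Lemma closure_leP A V : reflect (A `<=` V)%classic (closure A <= V).
Proof.
apply: (iffP idP) => [/moore_leP AV x /sub_closure /AV //|AV].
by apply/moore_leP; apply: smallest_sub => //; exact: mooreP.
Qed.

Lemma meet_subproof X Y : (X `&` Y)%classic \in C.
Proof.
apply: mem_set; pose XY := ([set X : set T] `|` [set Y : set T])%classic.
suff -> : (X `&` Y)%classic = \bigcap_(A in XY) A.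
  by apply: hC => A [->|->]; exact: mooreP.
by rewrite bigcap_setU !bigcap_set1.
Qed.

Definition moore_meet X Y : moore hC := Moore hC (meet_subproof X Y).
Definition moore_join X Y : moore hC := closure (X `|` Y)%classic.

Lemma moore_lexI V X Y : (V <= moore_meet X Y) = (V <= X) && (V <= Y).
Proof.
apply/moore_leP/andP => [VXY|[/moore_leP VX /moore_leP VY] x Vx].
  by split; apply/moore_leP => x /VXY[].
by split; [exact: VX|exact: VY].
Qed.

Lemma moore_leUx X Y V : (moore_join X Y <= V) = (X <= V) && (Y <= V).
Proof.
apply/closure_leP/andP => [XYV|[/moore_leP XV /moore_leP YV] x [/XV|/YV]//].
by split; apply/moore_leP => x xX; apply: XYV; [left|right].
Qed.

HB.instance Definition _ := Order.POrder_MeetJoin_isLattice.Build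
  moore_display (moore hC) moore_lexI moore_leUx.

Lemma moore_le0x X : closure set0 <= X.
Proof. by apply/closure_leP. Qed.

Lemma moore_lex1 X : X <= closure setT.
Proof. by apply/moore_leP => x _; exact: sub_closure. Qed.

HB.instance Definition _ :=
  Order.hasBottom.Build moore_display (moore hC) moore_le0x.
HB.instance Definition _ :=
  Order.hasTop.Build moore_display (moore hC) moore_lex1.

Lemma moore_meetE X Y : (X `&` Y)%O = (X `&` Y)%classic :> set T.
Proof. by []. Qed.

Lemma moore_topE : (\top : moore hC) = setT :> set T.
Proof. by apply/seteqP; split => // x _; apply: sub_closure. Qed.

End MooreLattice.

(** * Maps between lattices of closed sets *)

Section MooreMap.
Context {T U : Type} {C : set (set T)} {D : set (set U)}.
Variables (hC : moore_family C) (hD : moore_family D) (f : T -> U).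
Hypothesis fC : forall V, D V -> C (f @^-1` V)%classic.

Definition moore_map (X : moore hC) : moore hD := closure hD (f @` X)%classic.

(** The map is adjoint to taking preimages, so it preserves joins once preimages of closed sets are
    closed. *)
Lemma moore_map_leP (X : moore hC) (V : moore hD) :
  reflect (X `<=` f @^-1` V)%classic (moore_map X <= V).
Proof.
apply: (iffP (closure_leP _ _)) => XV x; first by move=> ?; apply: XV; exists x.
by case=> y /XV Vy <-.
Qed.

(** By [fC] the preimage of a closed [V] contains the closure of [A] as soon as it contains [A], so
    both sides have the same upper bounds. *)
Lemma moore_map_closure A :
  moore_map (closure hC A) = closure hD (f @` A)%classic.
Proof.
have ltV (V : moore hD) : (moore_map (closure hC A) <= V) =
    (closure hD (f @` A)%classic <= V).
  apply/moore_map_leP/closure_leP => AV.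
    by move=> _ [x Ax <-]; apply: AV; exact: sub_closure.
  apply: smallest_sub; first by apply: fC; exact: mooreP.
  by move=> x Ax; apply: AV; exists x.
by apply: le_anti; rewrite ltV lexx -ltV lexx.
Qed.

Lemma moore_map_join : {morph moore_map : X Y / (X `|` Y)%O}.
Proof.
move=> X Y; have -> : (X `|` Y)%O = closure hC (X `|` Y)%classic by [].
rewrite moore_map_closure; apply: le_anti; apply/andP; split.
  apply/closure_leP => _ [x [] xXY <-].
    by apply: (moore_leP _ _ (leUl _ _)); apply: sub_closure; exists x.
  by apply: (moore_leP _ _ (leUr _ _)); apply: sub_closure; exists x.
rewrite leUx; apply/andP; split; apply/closure_leP => _ [x xXY <-];
  apply: sub_closure; exists x => //; [by left|by right].
Qed.

Lemma moore_map_bot : moore_map \bot = \bot.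
Proof.
have -> : (\bot : moore hC) = closure hC set0 by [].
by rewrite moore_map_closure image_set0.
Qed.

End MooreMap.

(** * Lattice morphisms and their kernels *)

Lemma lmorphism_of (dK dL : Order.disp_t) (K : latticeType dK)
    (L : latticeType dL) (f : K -> L) :
  {morph f : x y / (x `&` y)%O} -> {morph f : x y / (x `|` y)%O} ->
  exists phi : {lmorphism K -> L}, phi =1 f.
Proof.
move=> fI fU.
have f_le : {homo f : x y / x <= y}.
  by move=> x y; rewrite !leEmeet -fI => /eqP ->.
pose o := Order.isOrderMorphism.Build _ K _ L f f_le.
pose g : {omorphism K -> L} := HB.pack f o.
pose l := Order.isLatticeMorphism.Build _ K _ L g fI fU.
pose phi : {lmorphism K -> L} := HB.pack f o l.
by exists phi.
Qed.

Lemma kernel_congruence (dK dL : Order.disp_t) (K : latticeType dK)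
    (L : latticeType dL) (f : K -> L) :
  {morph f : x y / (x `&` y)%O} -> {morph f : x y / (x `|` y)%O} ->
  lattice_congruence [set xy : K * K | f xy.1 = f xy.2]%classic.
Proof.
move=> fI fU; split => //=.
- by move=> x y z -> .
- by move=> x x' y y'; rewrite !fI => -> ->.
- by move=> x x' y y'; rewrite !fU => -> ->.
Qed.

(** * Closed sets of edge ends *)

Section ClosedSets.
Context {I : Type}.
Implicit Types (r m : I -> I -> Prop) (Z : set I) (X : set (I * bool)).

(* [(i, false)] stands for the lower end [a_i] and [(i, true)] for [b_i]; the
   edges in [Z] are degenerate.  If all are, only the full set is closed, and
   the lattice is trivial: this covers the case [0 = 1]. *)
Record proper_set r m Z X : Prop := ProperSet {
  proper_nontrivial : exists i, ~ Z i ;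
  proper_finite : finite_set X ;
  proper_clique : forall i j, X (i, false) -> X (j, false) -> r i j \/ r j i ;
  proper_down : forall i, X (i, true) -> X (i, false) ;
  proper_collapse : forall i, Z i -> X (i, false) -> X (i, true) ;
  proper_force : forall i j,
    r i j -> X (j, true) -> X (i, false) -> X (i, true) ;
  proper_bar : forall i j, m i j -> X (i, false) -> ~ X (j, true) }.

Definition closed_sets r m Z : set (set (I * bool)) :=
  [set X | proper_set r m Z X \/ X = setT]%classic.

Lemma proper_or_full r m Z X :
  closed_sets r m Z X -> (~ (exists i, ~ Z i)) -> X = setT.
Proof. by case=> // -[]. Qed.

(** Finiteness, the clique condition and the bars pass from one proper member of [F] to the
    intersection; the other closure conditions hold in every member. Without a proper member the
    intersection is full. *)
Lemma closed_sets_family r m Z : moore_family (closed_sets r m Z).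
Proof.
move=> F FC.
have [[X FX pX]|noP] := pselect (exists2 X, F X & proper_set r m Z X).
  left; split.
  - exact: (proper_nontrivial pX).
  - by apply: sub_finite_set (proper_finite pX) => x; exact.
  - by move=> i j /(_ _ FX) Xi /(_ _ FX); exact: (proper_clique pX).
  - move=> i Fi Y FY; have [pY|->//] := FC _ FY.
    exact: (proper_down pY) (Fi _ FY).
  - move=> i Zi Fi Y FY; have [pY|->//] := FC _ FY.
    exact: (proper_collapse pY) (Fi _ FY).
  - move=> i j rij Fj Fi Y FY; have [pY|->//] := FC _ FY.
    exact: (proper_force pY) rij (Fj _ FY) (Fi _ FY).
  - by move=> i j mij /(_ _ FX) Xi /(_ _ FX); exact: (proper_bar pX mij).
right; apply/seteqP; split=> // x _ Y FY; have [pY|->//] := FC _ FY.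
by case: noP; exists Y.
Qed.

End ClosedSets.

Arguments closed_sets_family {I} r m Z F _.

Notation lat r m Z := (moore (closed_sets_family r m Z)).

(** * Homomorphisms induced by embeddings of indices *)

Section LatMap.
Context {I J : Type}.
Variables (r m : I -> I -> Prop) (Z : set I).
Variables (s n : J -> J -> Prop) (W : set J) (e : I -> J).
Hypothesis e_inj : injective e.
Hypothesis rE : forall i j, r i j <-> s (e i) (e j).
Hypothesis mE : forall i j, m i j <-> n (e i) (e j).
Hypothesis ZW : forall i, Z i -> W (e i).
Hypothesis ZTW : (forall i, Z i) -> forall j, W j.
Hypothesis W_down : forall i j, s i j -> W j -> W i.
Hypothesis W_bar : forall i j, n i j -> W j -> forall k, W k.
Hypothesis r_incomplete : exists i j, ~ r i j /\ ~ r j i.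

Let f (x : I * bool) : J * bool := (e x.1, x.2).

Lemma lat_preim V : closed_sets s n W V -> closed_sets r m Z (f @^-1` V)%classic.
Proof.
case=> [pV|->]; last by right; rewrite preimage_setT.
left; split.
- have [j nWj] := proper_nontrivial pV.
  apply/not_existsP => nZ; apply: nWj; apply: ZTW => i; apply: contrapT.
  exact: nZ.
- apply: finite_preimage (proper_finite pV).
  by move=> [i a] [j b] _ _ [/e_inj -> ->].
- by move=> i j; rewrite !rE; exact: (proper_clique pV).
- by move=> i; exact: (proper_down pV).
- by move=> i /ZW; exact: (proper_collapse pV).
- by move=> i j; rewrite rE; exact: (proper_force pV).
- by move=> i j; rewrite mE; exact: (proper_bar pV).
Qed.

Definition lat_map : lat r m Z -> lat s n W :=
  moore_map (closed_sets_family s n W) f.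

(** Two unlinked indices keep the image of the full set from being proper. *)
Lemma lat_map_top : lat_map \top = \top.
Proof.
apply: le_anti; rewrite lex1 /=; apply/moore_leP => x _.
have [i [j [nij nji]]] := r_incomplete.
have [pV|->//] := mooreP (lat_map \top).
have fV k : moore_val (lat_map \top) (f (k, false)).
  by apply: sub_closure; exists (k, false) => //; rewrite moore_topE.
by case: (proper_clique pV (fV i) (fV j)); rewrite -rE.
Qed.

(** Joins are preserved by adjunction, but meets need this explicit form. Adding the upper ends that
    are degenerate in the target already gives a closed set: [W_down] makes it closed under forcing,
    and [W_bar] keeps barred pairs out. *)
Lemma lat_map_proper (X : lat r m Z) : (exists j, ~ W j) ->
  proper_set r m Z X -> lat_map X =
  (f @` X `|` [set (e i, true) |
    i in [set i | moore_val X (i, false) /\ W (e i)]])%classic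
  :> set _.
Proof.
move=> nW pX; set V := (_ `|` _)%classic.
have VF j : V (j, false) -> exists2 i, moore_val X (i, false) & j = e i.
  by case=> [[[i []]//= Xi [<-]]|[i [Xi _]]//]; exists i.
have VT j : V (j, true) ->
    exists i, [/\ moore_val X (i, false), j = e i &
      moore_val X (i, true) \/ W (e i)].
  case=> [[[i []]//= Xi [<-]]|[i [Xi Wi] [<-]]]; exists i; split; try by [];
    by [exact: (proper_down pX)|left|right].
have VFe i : V (e i, false) <-> moore_val X (i, false).
  split=> [/VF[k Xk /e_inj->//]|Xi]; by left; exists (i, false).
have VTe i : V (e i, true) <->
    moore_val X (i, false) /\ (moore_val X (i, true) \/ W (e i)).
  split=> [/VT[k [Xk /e_inj->//]]|[Xi [XTi|Wi]]].
    by left; exists (i, true).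
  by right; exists i.
have cV : closed_sets s n W V.
  left; split => //.
  - rewrite finite_setU; split; first exact/finite_image/(proper_finite pX).
    apply: finite_image.
    apply: (@sub_finite_set _ _ (fst @` X)%classic) => [i [Xi _]|].
      by exists (i, false).
    exact/finite_image/(proper_finite pX).
  - move=> i j /VF[i' Xi ->] /VF[j' Xj ->]; rewrite -!rE.
    exact: (proper_clique pX).
  - by move=> j /VT[i [Xi -> _]]; apply/VFe.
  - by move=> j Wj /VF[i Xi ji]; subst j; apply/VTe; split=> //; right.
  - move=> i j sij /VT[j' [Xj jj' Wj]] /VF[i' Xi ii']; subst i j.
    apply/VTe; split=> //; case: Wj => Wj; last by right; exact: W_down Wj.
    by left; apply: (proper_force pX _ Wj Xi); apply/rE.
  - move=> i j nij /VF[i' Xi ii'] /VT[j' [Xj jj' Wj]]; subst i j.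
    case: Wj => Wj; first by apply: (proper_bar pX _ Xi Wj); apply/mE.
    by case: nW => k; apply; exact: W_bar nij Wj k.
apply/seteqP; split.
  apply: smallest_sub => // x; exact: subsetUl.
move=> x [Xx|[i [Xi Wi] <-]]; first exact: sub_closure.
have [p|->//] := mooreP (lat_map X).
by apply: (proper_collapse p) => //; apply: sub_closure; exists (i, false).
Qed.

Lemma lat_map_meet : {morph lat_map : X Y / (X `&` Y)%O}.
Proof.
move=> X Y.
have [pX|XT] := mooreP X; last first.
  have -> : X = \top by apply: moore_eq; rewrite moore_topE.
  by rewrite lat_map_top !meet1x.
have [pY|YT] := mooreP Y; last first.
  have -> : Y = \top by apply: moore_eq; rewrite moore_topE.
  by rewrite lat_map_top !meetx1.
have [nW|tW] := pselect (exists j, ~ W j); last first.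
  by apply: moore_eq; rewrite !(proper_or_full (mooreP _) tW).
have pXY : proper_set r m Z (X `&` Y)%O.
  have [//|XYT] := mooreP (X `&` Y)%O.
  suff -> : (X `&` Y)%O = X :> set _ by [].
  by apply/seteqP; split=> [x []//|x _]; rewrite XYT.
apply: moore_eq; rewrite moore_meetE !lat_map_proper //.
apply/seteqP; split => [x [[y [Xy Yy] <-]|[i [[Xi Yi] Wi] <-]]|].
- by split; left; exists y.
- by split; right; exists i.
move=> x [[[y Xy <-]|[i [Xi Wi] <-]] [[y' Yy']|[i' [Yi' Wi']]]].
- rewrite /f => -[yy' yy2]; left; exists y => //; split=> //.
  case: y Xy yy' yy2 => i b /= Xi; case: y' Yy' => j b' /= Yj /e_inj ji bb.
  by rewrite -ji -bb.
(* An upper end that comes from [X] and is added to the image of [Y] has its lower end in both, so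
   it is added to the image of the meet as well. *)
- case: y Xy => i b /= Xi [/e_inj ii' bb]; subst i' b; right; exists i => //.
  by split=> //; split=> //; exact: (proper_down pX).
- case: y' Yy' => j b /= Yj [/e_inj ii' bb]; subst j b; right; exists i => //.
  by split=> //; split=> //; exact: (proper_down pY).
- by case=> /e_inj ii'; subst i'; right; exists i.
Qed.

Lemma lat_map_join : {morph lat_map : X Y / (X `|` Y)%O}.
Proof. exact: moore_map_join lat_preim. Qed.

Lemma lat_map_bot : lat_map \bot = \bot.
Proof. exact: moore_map_bot lat_preim. Qed.

Lemma lat_map_closure A :
  lat_map (closure _ A) = closure _ (f @` A)%classic.
Proof. exact: moore_map_closure lat_preim _. Qed.

End LatMap.

(** * Finite sets, and frames of colored indices *)

Lemma finite_enum (T : eqType) (A : set T) : finite_set A ->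
  exists s : seq T, forall i, i \in s <-> A i.
Proof. by move=> /finite_seqP[s ->]; exists s. Qed.

Lemma exists_max (d : Order.disp_t) (Q : porderType d) (I : eqType)
    (c : I -> Q) (i0 : I) (s : seq I) :
  {in i0 :: s &, forall i j, c i <= c j \/ c j <= c i} ->
  exists2 i, i \in i0 :: s & {in i0 :: s, forall j, c j <= c i}.
Proof.
elim: s i0 => [|i1 s IH] i0 cmp.
  by exists i0; rewrite ?mem_head // => j; rewrite inE => /eqP ->.
have [|i si maxi] := IH i1.
  by move=> j k sj sk; apply: cmp; rewrite inE ?sj ?sk orbT.
have si0 : i \in [:: i0, i1 & s] by rewrite inE si orbT.
have [ci|ci] := cmp i0 i (mem_head _ _) si0.
  exists i => //; by move=> j; rewrite inE => /orP[/eqP ->|/maxi].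
exists i0; first by rewrite mem_head.
by move=> j; rewrite inE => /orP[/eqP ->|/maxi /le_trans]; [|apply].
Qed.

(* A barred pair [m i j] makes [a_i] and [b_j] join to [1], while [a_i] and [a_j]
   have a proper join: thus collapsing the edge of [rep \top] collapses 0 and 1. *)
Record frame (d : Order.disp_t) (Q : tbPOrderType d) (I : Type)
    (r m : I -> I -> Prop) (c : I -> Q) (rep : Q -> I) : Prop := Frame {
  frame_refl : forall i, r i i ;
  frame_color : forall i j, r i j -> c i <= c j ;
  frame_bar : forall i j, m i j -> [/\ r i j, c i = \bot & c j = \top] ;
  frame_rep : cancel rep c ;
  frame_rep_le : forall q q', q <= q' -> r (rep q) (rep q') ;
  frame_rep_color : forall i,
    c i = \bot \/ r i (rep (c i)) /\ r (rep (c i)) i ;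
  frame_rep_top : exists i, m i (rep \top) ;
  frame_isolated : forall j k, exists s,
    [/\ forall i, r i s \/ r s i -> i = s, s <> j & s <> k] }.

(** The degenerate edges: those for [\bot] define the lattice itself, those for [q] its quotient by
    the congruence of [q]. *)
Definition color_below (d : Order.disp_t) (Q : porderType d) (I : Type)
    (c : I -> Q) (q : Q) : set I := [set i | c i <= q]%classic.

(** * The lattice of a frame *)

Section FrameLattice.
Context {d : Order.disp_t} {Q : tbPOrderType d} {I : choiceType}.
Context {r m : I -> I -> Prop} {c : I -> Q} {rep : Q -> I}.
Hypothesis F : frame r m c rep.

Notation below := (color_below c).
Notation L q := (lat r m (below q)).
Notation cl q := (closure (closed_sets_family r m (below q))).
Notation "X @ x" := (moore_val X x) (at level 10).

(** An isolated index is linked to no other index. *)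
Lemma frame_incomplete : exists i j, ~ r i j /\ ~ r j i.
Proof.
have [s [iso _ _]] := frame_isolated F (rep \bot) (rep \bot).
have [t [_ ts _]] := frame_isolated F s s.
by exists t, s; split=> rts; apply/ts/iso; [left|right].
Qed.

Lemma lat_trivial q (X Y : L q) : ~ (exists i, ~ below q i) -> X = Y.
Proof.
by move=> tr; apply: moore_eq; rewrite !(proper_or_full (mooreP _) tr).
Qed.

Lemma below_top : ~ (exists i, ~ below \top i).
Proof. by case=> i; apply; exact: lex1. Qed.

Lemma mem_below_bar q i j : m i j -> below q j -> forall k, below q k.
Proof.
move=> /(frame_bar F)[_ _ cj]; rewrite /color_below /= cj => qT k.
exact: le_trans (lex1 _) qT.
Qed.

(** A source of explicit closed sets, with support [S] and upper ends allowed on [D], that bound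
    generated elements from above. *)
Lemma closed_clique q (S D : set I) : (exists i, ~ below q i) ->
  finite_set S -> (forall i j, S i -> S j -> r i j \/ r j i) ->
  (forall i, below q i -> S i -> D i) ->
  (forall i j, r i j -> S i -> S j -> D j -> D i) ->
  (forall i j, m i j -> S i -> S j -> ~ D j) ->
  closed_sets r m (below q) [set x : I * bool | S x.1 /\ (x.2 -> D x.1)]%classic.
Proof.
move=> nt finS cliS ZD rD mD; left; split => //=.
- apply: (@sub_finite_set _ _ (S `*` setT)%classic); first by move=> x [].
  exact: finite_setX.
- by move=> i j [Si _] [Sj _]; exact: cliS.
- by move=> i [].
- by move=> i Zi [Si _]; split=> // _; exact: ZD.
- by move=> i j rij [Sj /(_ isT) Dj] [Si _]; split=> // _; exact: rD Dj.
- by move=> i j mij [Si _] [Sj /(_ isT)]; exact: mD mij Si Sj.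
Qed.

(** This set bounds the join of [a_j] and [a_k], which therefore stays proper and contains no upper
    end of a nondegenerate edge. *)
Lemma closed_bare q j k : (exists i, ~ below q i) -> r j k ->
  closed_sets r m (below q)
    [set x : I * bool | (x.1 = j \/ x.1 = k) /\ (x.2 -> below q x.1)]%classic.
Proof.
move=> nt rjk; apply: (@closed_clique q [set i | i = j \/ i = k]%classic) => //.
- rewrite (_ : [set _ | _] = [set j; k])%classic //; exact: finite_set2.
- by move=> i i' /= [->|->] [->|->]; have := frame_refl F; auto.
- by move=> i i' /(frame_color F) ii' _ _; exact: le_trans.
- by move=> i i' mii' _ _ /(mem_below_bar mii') all; case: nt => l; apply.
Qed.

(** * The ends of an edge, and meets with them *)

Section Edge.
Variable q : Q.
Implicit Types (i j k : I) (X Y : L q).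

Definition lo i : L q := cl q [set (i, false)]%classic.
Definition hi i : L q := cl q [set (i, true)]%classic.

Lemma lo_le i X : lo i <= X <-> X @ (i, false).
Proof.
split=> [/closure_leP|Xi]; first by apply.
by apply/closure_leP => x ->.
Qed.

Lemma hi_le i X : hi i <= X <-> X @ (i, true).
Proof.
split=> [/closure_leP|Xi]; first by apply.
by apply/closure_leP => x ->.
Qed.

Lemma mem_lo i : (lo i) @ (i, false). Proof. exact/lo_le. Qed.
Lemma mem_hi i : (hi i) @ (i, true). Proof. exact/hi_le. Qed.

Lemma mem_down i X : X @ (i, true) -> X @ (i, false).
Proof. by case: (mooreP X) => [/proper_down|->]; [apply|]. Qed.

Lemma lo_le_hi i : lo i <= hi i.
Proof. by apply/lo_le; apply: mem_down; exact: mem_hi. Qed.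

Lemma lo_below i : below q i -> lo i = hi i.
Proof.
move=> qi; apply: le_anti; rewrite lo_le_hi /=; apply/hi_le.
have := @mem_lo i; case: (mooreP (lo i)) => [p|->//].
exact: proper_collapse p i qi.
Qed.

Lemma lo_hi_below i : lo i = hi i -> below q i.
Proof.
move=> e; apply: contrapT => nqi; have nt : exists i, ~ below q i by exists i.
have cl_i := closed_bare nt (frame_refl F i).
pose V : L q := Moore _ (mem_set cl_i).
have : lo i <= V by apply/lo_le; split=> //; left.
by rewrite e hi_le => -[_ /(_ isT)].
Qed.

Lemma hi_sub i x : (exists i, ~ below q i) -> (hi i) @ x -> x.1 = i.
Proof.
move=> nt; pose S := [set i]%classic.
have cl_i : closed_sets r m (below q)
    [set x : I * bool | S x.1 /\ (x.2 -> S x.1)]%classic.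
  apply: closed_clique => //; first exact: finite_set1.
    by move=> j k -> ->; left; exact: (frame_refl F).
  (* An index barred from itself would have both colors [\bot] and [\top], and every edge would be
     degenerate. *)
  move=> j k mjk Sj Sk _; have jk : j = k by rewrite Sj Sk.
  subst k; have [_ ci cj] := frame_bar F mjk.
  case: nt => l; apply; apply: (mem_below_bar mjk).
  by rewrite /color_below /= ci; exact: le0x.
pose V : L q := Moore _ (mem_set cl_i).
have /moore_leP iV : hi i <= V by apply/hi_le.
by move=> /iV[].
Qed.

(** By [hi_sub], meeting with [b_i] cuts out the part of [X] on edge [i]; this and the next two
    lemmas treat the three possible parts. *)
Lemma meet_hi_bot i X : ~ X @ (i, false) -> (X `&` hi i)%O = \bot.
Proof.
move=> Xi; have [nt|tr] := pselect (exists i, ~ below q i); last first.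
  exact: lat_trivial.
apply: le_anti; rewrite le0x andbT; apply/moore_leP => -[j b] [Xj].
move=> /(hi_sub nt)/= ji; subst j; case: Xi; case: b Xj => //; exact: mem_down.
Qed.

Lemma meet_hi_lo i X : X @ (i, false) -> ~ X @ (i, true) ->
  (X `&` hi i)%O = lo i.
Proof.
move=> XFi XTi; have [nt|tr] := pselect (exists i, ~ below q i); last first.
  exact: lat_trivial.
apply: le_anti; apply/andP; split; last by rewrite lexI lo_le_hi andbT; apply/lo_le.
apply/moore_leP => -[j b] [Xj] /(hi_sub nt)/= ji; subst j.
by case: b Xj => // _; exact: mem_lo.
Qed.

Lemma meet_hi_hi i X : X @ (i, true) -> (X `&` hi i)%O = hi i.
Proof. by move=> Xi; apply/meet_idPr; apply/hi_le. Qed.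

Lemma meet_lo_bot i X : ~ X @ (i, false) -> (X `&` lo i)%O = \bot.
Proof.
move=> Xi; apply: le_anti; rewrite le0x andbT -(meet_hi_bot Xi).
exact: leI2 (lexx _) (lo_le_hi i).
Qed.

Lemma isolated_full i s X : (forall i, r i s \/ r s i -> i = s) ->
  s <> i -> X @ (i, false) -> X @ (s, false) -> X = \top.
Proof.
move=> iso si Xi Xs; apply: moore_eq; rewrite moore_topE.
have [p|//] := mooreP X; case: si; symmetry; apply: iso.
exact: proper_clique p i s Xi Xs.
Qed.

Lemma full_of_support X : (forall i, X @ (i, false)) -> X = \top.
Proof.
move=> Xall; have [i [j [nij nji]]] := frame_incomplete.
apply: moore_eq; rewrite moore_topE; have [p|//] := mooreP X.
by case: (proper_clique p (Xall i) (Xall j)).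
Qed.

End Edge.

Notation a := (lo \bot).
Notation b := (hi \bot).

(** * What a congruence is forced to collapse *)

Section Collapse.
Variable R : set (L \bot * L \bot).
Hypothesis cR : lattice_congruence R.

Lemma congrI X Y V : R (X, Y) -> R (X `&` V, Y `&` V)%O.
Proof. by move=> XY; apply: (congr_meet cR XY); exact: (congr_refl cR). Qed.

Lemma congrU X Y V : R (X, Y) -> R (X `|` V, Y `|` V)%O.
Proof. by move=> XY; apply: (congr_join cR XY); exact: (congr_refl cR). Qed.

Lemma congr_bot_top : R (\bot, \top) -> forall X Y, R (X, Y).
Proof.
move=> R01; have R0 X : R (\bot, X).
  by have := congrI X R01; rewrite meet0x meet1x.
by move=> X Y; apply: (congr_trans cR) (R0 Y); exact: (congr_sym cR).
Qed.

(** Take isolated [s] and [t], distinct from each other and from [k]. Joining [0 ~ a_k] with [a_s]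
    and with [a_t] gives [a_s ~ 1] and [a_t ~ 1]; meeting the latter with [a_s] gives [0 ~ a_s],
    hence [0 ~ 1]. *)
Lemma collapse_atom k : R (\bot, a k) -> forall X Y, R (X, Y).
Proof.
move=> Rk; apply: congr_bot_top.
have [nt|tr] := pselect (exists i, ~ below \bot i); last first.
  by rewrite (lat_trivial \top \bot tr); exact: (congr_refl cR).
have up s : (forall i, r i s \/ r s i -> i = s) -> s <> k -> R (a s, \top).
  move=> iso sk; have := congrU (a s) Rk; rewrite join0x.
  rewrite (@isolated_full _ k s (_ `|` _)%O) //; first exact/lo_le/leUl.
  exact/lo_le/leUr.
have down s l : R (a s, \top) -> l <> s -> R (\bot, a l).
  move=> /(congrI (a l)); rewrite meet1x => Rs ls; move: Rs.
  rewrite meet_lo_bot // => al; apply: ls.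
  have /moore_leP/(_ _ al) := lo_le_hi \bot s.
  by move=> /(hi_sub nt).
have [s [iso_s sk _]] := frame_isolated F k k.
have [t [iso_t tk ts]] := frame_isolated F k s.
apply: (congr_trans cR) (up s iso_s sk).
by apply: down (up t iso_t tk) _; exact: nesym.
Qed.

(** Join with [a_j], then meet with [b_j]: the side of [a_k] becomes [a_j], and the side of [b_k]
    becomes [b_j] because the link forces it. *)
Lemma collapse_force j k : r j k -> R (a k, b k) -> R (a j, b j).
Proof.
move=> rjk Rk; have [Zj|nZj] := pselect (below \bot j).
  by rewrite (lo_below Zj); exact: (congr_refl cR).
have nt : exists i, ~ below \bot i by exists j.
have := congrI (b j) (congrU (a j) Rk).
rewrite meet_hi_lo; first 1 last.
- exact/lo_le/leUr.
- pose V : L \bot := Moore _ (mem_set (closed_bare nt rjk)).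
  have /moore_leP le_V : (a k `|` a j)%O <= V.
    rewrite leUx; apply/andP; split; apply/lo_le; split=> //; [by right|by left].
  by move=> /le_V[_ /(_ isT)].
rewrite meet_hi_hi //.
have Yk : (b k `|` a j)%O @ (k, true) by apply/hi_le; exact: leUl.
have Yj : (b k `|` a j)%O @ (j, false) by apply/lo_le; exact: leUr.
have [p|->//] := mooreP (b k `|` a j)%O.
exact: (proper_force p rjk Yk Yj).
Qed.

(** The links lead from [j] through the representatives of [c j] and [c i] to [i]; edges of color
    [\bot] are degenerate anyway. *)
Lemma collapse_color i j : c j <= c i -> R (a i, b i) -> R (a j, b j).
Proof.
move=> cji Ri; have [cj0|[rj _]] := frame_rep_color F j.
  rewrite lo_below; first exact: (congr_refl cR).
  by rewrite /color_below /= cj0 lexx.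
apply: collapse_force rj _; apply: collapse_force (frame_rep_le F cji) _.
have [ci0|[_ ri]] := frame_rep_color F i; last exact: collapse_force ri Ri.
rewrite lo_below; first exact: (congr_refl cR).
by rewrite /color_below /= (frame_rep F) ci0 lexx.
Qed.

(** Let [z] be barred from [rep \top]. Joining the collapsed edge of [rep \top] with [a_z] yields
    [1] on one side and only the support [z], [rep \top] on the other; meeting with [a_u] for a
    third index [u] gives [0 ~ a_u]. *)
Lemma collapse_top i : c i = \top -> R (a i, b i) -> forall X Y, R (X, Y).
Proof.
move=> ci /(@collapse_color i (rep \top)); rewrite ci lex1 => /(_ isT) Rt.
have [nt|tr] := pselect (exists i, ~ below \bot i); last first.
  by move=> X Y; rewrite (lat_trivial X Y tr); exact: (congr_refl cR).
have [z mz] := frame_rep_top F; have [rz _ _] := frame_bar F mz.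
have [u [_ uz ut]] := frame_isolated F z (rep \top).
apply: (@collapse_atom u); have := congrI (a u) (congrU (a z) Rt).
have -> : (b (rep \top) `|` a z)%O = \top.
  apply: moore_eq; rewrite moore_topE.
  have Yt : (b (rep \top) `|` a z)%O @ (rep \top, true).
    by apply/hi_le; exact: leUl.
  have Yz : (b (rep \top) `|` a z)%O @ (z, false) by apply/lo_le; exact: leUr.
  have [p|->//] := mooreP (b (rep \top) `|` a z)%O.
  by case: (proper_bar p mz Yz).
rewrite meet1x meet_lo_bot //.
pose V : L \bot := Moore _ (mem_set (closed_bare nt rz)).
have /moore_leP le_V : (a (rep \top) `|` a z)%O <= V.
  rewrite leUx; apply/andP; split; apply/lo_le; split=> //; [by right|by left].
by move=> /le_V[[]].
Qed.

(** The upper ends are joined to [X] one at a time. Minimality of [Y] serves to identify it with the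
    image of [X] in a quotient. *)
Lemma collapse_seq (X : L \bot) (s : seq I) :
  (forall i, i \in s -> X @ (i, false) /\ R (a i, b i)) ->
  exists Y : L \bot, [/\ R (X, Y), X <= Y, forall i, i \in s -> Y @ (i, true) &
    forall V : L \bot, X <= V -> (forall i, i \in s -> V @ (i, true)) -> Y <= V].
Proof.
elim: s => [|i s IH] hs.
  by exists X; split=> //; exact: (congr_refl cR).
have [|Y [XY leXY Ys minY]] := IH.
  by move=> j js; apply: hs; rewrite inE js orbT.
have [Xi Ri] := hs i (mem_head _ _).
exists (b i `|` Y)%O; split.
- have -> : X = (a i `|` X)%O by rewrite join_r //; apply/lo_le.
  exact: (congr_join cR Ri XY).
- exact: le_trans leXY (leUr _ _).
- move=> j; rewrite inE => /orP[/eqP ->|js]; first exact/hi_le/leUl.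
  by apply: (moore_leP _ _ (leUr _ _)); exact: Ys.
- move=> V XV sV; rewrite leUx; apply/andP; split.
    by apply/hi_le/sV; exact: mem_head.
  by apply: minY => // j js; apply: sV; rewrite inE js orbT.
Qed.

End Collapse.

(** * Quotients and principal congruences *)

Definition quot q : L \bot -> L q :=
  @lat_map I I r m (below \bot) r m (below q) id.

Lemma below_bot q i : below \bot i -> below q i.
Proof. by move=> /le_trans; apply; exact: le0x. Qed.

Lemma below_bot_all q : (forall i, below \bot i) -> forall i, below q i.
Proof. by move=> all i; exact: below_bot. Qed.

Lemma below_down q i j : r i j -> below q j -> below q i.
Proof. by move=> /(frame_color F); exact: le_trans. Qed.

(** Thus an element of the quotient can be read as an element of the lattice. *)
Lemma closed_below q V :
  closed_sets r m (below q) V -> closed_sets r m (below \bot) V.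
Proof.
move=> cV; have -> : V = ((fun x => (id x.1, x.2)) @^-1` V)%classic.
  by apply/seteqP; split=> -[].
apply: (@lat_preim _ _ r m (below \bot) r m (below q) id) cV => //.
  exact: below_bot.
exact: below_bot_all.
Qed.

Lemma quot_proper q (X : L \bot) :
  (exists j, ~ below q j) -> proper_set r m (below \bot) X ->
  quot q X = (X `|` [set (i, true) | i in
    [set i | X @ (i, false) /\ below q i]])%classic :> set _.
Proof.
move=> nt pX; rewrite /quot lat_map_proper //.
- by congr setU; apply/seteqP; split=> [[i e] [[j e'] Xj [<- <-]]//|[i e] Xi];
    exists (i, e).
- exact: below_down.
- exact: mem_below_bar.
Qed.

Lemma quot_lo q i : quot q (a i) = lo q i.
Proof.
rewrite /quot /lo lat_map_closure ?image_set1 //.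
  exact: below_bot.
exact: below_bot_all.
Qed.

Lemma quot_hi q i : quot q (b i) = hi q i.
Proof.
rewrite /quot /hi lat_map_closure ?image_set1 //.
  exact: below_bot.
exact: below_bot_all.
Qed.

Lemma quot_le q (X : L \bot) (V : L q) : quot q X <= V <-> (X `<=` V)%classic.
Proof.
split=> [/moore_map_leP XV [i e]|XV]; first exact: XV.
by apply/moore_map_leP => -[i e]; exact: XV.
Qed.

Lemma quot_top q : quot q \top = \top.
Proof. exact: lat_map_top frame_incomplete. Qed.

Definition theta q : set (L \bot * L \bot) :=
  [set XY | quot q XY.1 = quot q XY.2]%classic.

Lemma theta_congruence q : lattice_congruence (theta q).
Proof.
apply: kernel_congruence.
- apply: lat_map_meet => //.
  + exact: below_down.
  + exact: mem_below_bar.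
  + exact: frame_incomplete.
- apply: lat_map_join => //; [exact: below_bot|exact: below_bot_all].
Qed.

Lemma theta_min q i (R : set (L \bot * L \bot)) : lattice_congruence R ->
  c i = q -> R (a i, b i) -> (theta q `<=` R)%classic.
Proof.
move=> cR ci Ri [X Y]; rewrite /theta /= => XY.
have [qT|qT] := eqVneq q \top.
  by apply: (collapse_top cR) Ri _ _; rewrite ci.
have nt : exists j, ~ below q j.
  exists (rep \top); rewrite /color_below /= (frame_rep F).
  by move=> /(conj (lex1 q))/andP/le_anti; exact/eqP.
(* If each [V] is congruent to its image read back in the lattice, then elements with equal images
   are congruent. *)
suff toquot V : exists2 W : L \bot, R (V, W) & W = quot q V :> set _.
  have [X' XX' eX] := toquot X; have [Y' YY' eY] := toquot Y.
  have e : X' = Y' by apply: moore_eq; rewrite eX eY XY.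
  by apply: (congr_trans cR XX'); rewrite e; exact: (congr_sym cR).
have [pV|VT] := mooreP V; last first.
  have -> : V = \top by apply: moore_eq; rewrite moore_topE.
  exists \top; first exact: (congr_refl cR).
  by rewrite quot_top !moore_topE.
pose W : L \bot := Moore _ (mem_set (closed_below (mooreP (quot q V)))).
have WE : moore_val W = _ := quot_proper nt pV.
(* Finite support lets finitely many joins reach the image. *)
have : finite_set [set i | V @ (i, false) /\ below q i]%classic.
  apply: (@sub_finite_set _ _ (fst @` V)%classic) => [j [Vj _]|].
    by exists (j, false).
  exact/finite_image/(proper_finite pV).
move=> /finite_enum[s ins].
have [|Y' [VY leVY sY minY]] := @collapse_seq R cR V s.
  move=> j /ins[Vj qj]; split=> //; apply: (collapse_color cR) Ri.
  by rewrite ci.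
suff YW : Y' = W by exists W => //; rewrite -YW.
apply: le_anti; apply/andP; split.
  apply: minY => [|j /ins jq]; first by apply/moore_leP => x Vx; rewrite WE; left.
  by rewrite WE; right; exists j.
apply/moore_leP => x; rewrite WE => -[|[j jq <-]]; first exact/moore_leP.
exact/sY/ins.
Qed.

Lemma con_edge i : con (a i) (b i) = theta (c i).
Proof.
apply/seteqP; split.
  apply: con_min; first exact: theta_congruence.
  by rewrite /theta /= quot_lo quot_hi; apply: lo_below; exact: lexx.
apply: (theta_min (con_congruence _ _) erefl); exact: con_gen.
Qed.

Lemma theta_rep q : con (a (rep q)) (b (rep q)) = theta q.
Proof. by rewrite con_edge (frame_rep F). Qed.

Lemma theta_le q q' : (theta q `<=` theta q')%classic <-> q <= q'.
Proof.
split=> [sub|qq'].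
  have /sub : theta q (a (rep q), b (rep q)) by rewrite -theta_rep; exact: con_gen.
  rewrite /theta /= quot_lo quot_hi => /lo_hi_below.
  by rewrite /color_below /= (frame_rep F).
apply: (theta_min (theta_congruence q') (frame_rep F q)).
rewrite /theta /= quot_lo quot_hi; apply: lo_below.
by rewrite /color_below /= (frame_rep F).
Qed.

Lemma con_theta (X Y : L \bot) : X <= Y -> exists q, con X Y = theta q.
Proof.
move=> leXY; have cXY := con_congruence X Y; have gXY := con_gen X Y.
have [<-|nXY] := pselect (X = Y).
  exists \bot; apply/seteqP; split; last first.
    rewrite -theta_rep; apply: con_min (con_congruence X X) _.
    rewrite lo_below; first exact: (congr_refl (con_congruence X X)).
    by rewrite /color_below /= (frame_rep F) lexx.
  by apply: con_min; [exact: theta_congruence|].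
have [[i Yi nXi]|supp] := pselect (exists2 i, Y @ (i, false) & ~ X @ (i, false)).
  exists \top; apply/seteqP; split.
    apply: con_min; first exact: theta_congruence.
    exact: (lat_trivial _ _ below_top).
  move=> [V W] _; apply: (@collapse_atom _ cXY i).
  (* Meeting with [a_i] turns a difference of supports into [0 ~ a_i]. *)
  have := congrI cXY (a i) gXY; rewrite meet_lo_bot //.
  by rewrite meet_r //; apply/lo_le.
have XT : X <> \top.
  by move=> XT; apply: nXY; apply: le_anti; rewrite leXY XT lex1.
have [pX|/esym XT'] := mooreP X; last first.
  by case: XT; apply: moore_eq; rewrite moore_topE.
have suppXY i : Y @ (i, false) -> X @ (i, false).
  by move=> Yi; apply: contrapT => nXi; apply: supp; exists i.
have [pY|YT] := mooreP Y; last first.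
  by case: XT; apply: full_of_support => i; apply: suppXY; rewrite YT.
have : finite_set [set i | Y @ (i, true) /\ ~ X @ (i, true)]%classic.
  apply: (@sub_finite_set _ _ (fst @` Y)%classic) => [i [Yi _]|].
    by exists (i, true).
  exact/finite_image/(proper_finite pY).
move=> /finite_enum[[|i0 s] ins].
  case: nXY; apply: le_anti; rewrite leXY /=; apply/moore_leP => -[i []] Yi.
    by apply: contrapT => nXi; have /ins : Y @ (i, true) /\ ~ X @ (i, true).
  exact: suppXY.
(* The differing indices lie in the clique supporting [Y], so their colors are pairwise
   comparable. *)
have [|i /ins[Yi nXi] maxi] := @exists_max _ Q I c i0 s.
  move=> i j /ins[/(proper_down pY) Yi _] /ins[/(proper_down pY) Yj _].
  by have [/(frame_color F)|/(frame_color F)] := proper_clique pY Yi Yj; auto.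
have XFi := suppXY _ (proper_down pY Yi).
exists (c i); rewrite -con_edge; apply/seteqP; split; last first.
  (* Meeting with [b_i] sends [X] to [a_i] and [Y] to [b_i]. *)
  apply: con_min => //; have := congrI cXY (b i) gXY.
  by rewrite meet_hi_lo // meet_hi_hi.
rewrite con_edge; apply: con_min; first exact: theta_congruence.
rewrite /theta /=; apply: le_anti; apply/andP; split; apply/quot_le.
  move=> x Xx; have /quot_le := lexx (quot (c i) Y); apply.
  exact: (moore_leP _ _ leXY).
have /quot_le Xq := lexx (quot (c i) X).
move=> [j []] Yj; last by apply: Xq; exact: suppXY.
have [Xj|nXj] := pselect (X @ (j, true)); first exact: Xq.
(* By maximality of [c i], every differing edge is degenerate in the quotient. *)
have Zj : below (c i) j by apply: maxi; apply/ins.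
have qj : (quot (c i) X) @ (j, false).
  by apply: Xq; apply: suppXY; exact: proper_down pY _ Yj.
have [p|->//] := mooreP (quot (c i) X).
exact: proper_collapse p j Zj qj.
Qed.

(** * The isomorphism onto the principal congruences *)

Definition edge_princ i : Princ (L \bot) := to_Princ (lo_le_hi \bot i).

Lemma edge_princ_color i j : c i = c j -> edge_princ i = edge_princ j.
Proof. by move=> cij; apply: val_inj; rewrite /= !con_edge cij. Qed.

Definition frame_map q : Princ (L \bot) := edge_princ (rep q).

Lemma frame_representation : order_isomorphism frame_map.
Proof.
have mono : {mono frame_map : q q' / q <= q'}.
  move=> q q'; rewrite Princ_leE /= !theta_rep.
  by apply/asboolP/idP => /theta_le.
split=> //.
have surj (x : Princ (L \bot)) : exists q, frame_map q = x.
  have [[X Y] /= [XY xE]] := Princ_gen x; have [q qE] := con_theta XY.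
  by exists q; apply: val_inj; rewrite /= theta_rep xE qE.
exists (fun x => projT1 (cid (surj x))) => [q|x]; case: cid => //= q' e.
by apply: le_anti; rewrite -!mono e lexx.
Qed.

End FrameLattice.

Arguments frame_map {d Q I} r m c rep q.

(** * The two frames and the embedding *)

(** The offset 2 skips the numbers that serve as bars. *)
Lemma exists_fresh (A : Type) (x y : A + nat) :
  exists n, inr n.+2 <> x /\ inr n.+2 <> y.
Proof.
pose num (z : A + nat) := if z is inr k then k else 0.
exists (num x + num y); split.
  case: x => //= k [] /eqP.
  by rewrite -addn2 -addnA -[X in _ == X]addn0 eqn_add2l addn2.
case: y => //= k [] /eqP.
by rewrite -addn2 addnAC -[X in _ == X]add0n eqn_add2r addn2.
Qed.

Section Frames.
Context {dP dQ : Order.disp_t} {P : tbPOrderType dP} {Q : tbPOrderType dQ}.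
Variable psi : P -> Q.
Hypothesis psi_isotone : {homo psi : x y / x <= y}.
Hypothesis psi_bot : psi \bot = \bot.
Hypothesis psi_top : psi \top = \top.

(* The number 0 serves as bar for the top of [P], 1 for the top of [Q] (which
   in [K] is one more isolated index), and the others are isolated. *)
Definition source_bar (x y : P + nat) : Prop :=
  if (x, y) is (inr 0, inl p) then p = \top else False.

Definition source_force (x y : P + nat) : Prop :=
  match x, y with
  | inl p, inl p' => p <= p'
  | inr k, inr k' => k = k'
  | _, _ => source_bar x y
  end.

Definition source_color (x : P + nat) : P := if x is inl p then p else \bot.

Definition target_bar (x y : P + Q + nat) : Prop :=
  match x, y with
  | inr 0, inl (inl p) => p = \top
  | inr 1, inl (inr q) => q = \top
  | _, _ => False
  end.

(** Links within [P] follow its own order, not that of the images under [psi], so that [embed]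
    reflects links. *)
Definition target_force (x y : P + Q + nat) : Prop :=
  match x, y with
  | inl (inl p), inl (inl p') => p <= p'
  | inl (inr q), inl (inr q') => q <= q'
  | inl (inl p), inl (inr q) => psi p = q
  | inl (inr q), inl (inl p) => psi p = q
  | inr k, inr k' => k = k'
  | _, _ => target_bar x y
  end.

Definition target_color (x : P + Q + nat) : Q :=
  match x with inl (inl p) => psi p | inl (inr q) => q | inr _ => \bot end.

Lemma source_frame : frame source_force source_bar source_color inl.
Proof.
split.
- by case=> /=.
- by move=> [p|k] [p'|k'] //=; exact: le0x.
- by move=> [p|[|k]] [p'|k'] //= ->.
- by [].
- by [].
- by case=> [p|k] /=; [right|left].
- by exists (inr 0).
- move=> j k; have [n [nj nk]] := exists_fresh j k.
  by exists (inr n.+2); split=> // -[p|[|[|l]]] [] //= ->.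
Qed.

Lemma target_frame :
  frame target_force target_bar target_color (fun q => inl (inr q)).
Proof.
split.
- by case=> [[p|q]|k] /=.
- move=> [[p|q]|k] [[p'|q']|k'] //=; try exact: le0x; try by move=> ->.
  exact: psi_isotone.
- by move=> [[p|q]|[|[|k]]] [[p'|q']|k'] //= ->; rewrite ?psi_top.
- by [].
- by [].
- by case=> [[p|q]|k] /=; [right|right|left].
- by exists (inr 1).
- move=> j k; have [n [nj nk]] := exists_fresh j k.
  by exists (inr n.+2); split=> // -[[p|q]|[|[|l]]] [] //= ->.
Qed.

Definition embed (x : P + nat) : P + Q + nat :=
  match x with inl p => inl (inl p) | inr k => inr k end.

Lemma embed_inj : injective embed.
Proof. by move=> [p|k] [p'|k'] //= [->]. Qed.

Lemma embed_bar x y : source_bar x y <-> target_bar (embed x) (embed y).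
Proof. by case: x => [p|[|[|k]]]; case: y. Qed.

Lemma embed_force x y : source_force x y <-> target_force (embed x) (embed y).
Proof. by case: x => [p|[|[|k]]]; case: y. Qed.

Lemma embed_color x : target_color (embed x) = psi (source_color x).
Proof. by case: x => //= k; rewrite psi_bot. Qed.

Lemma embed_below x :
  color_below source_color \bot x -> color_below target_color \bot (embed x).
Proof.
by rewrite /color_below /= embed_color => /psi_isotone; rewrite psi_bot.
Qed.

(** If [\top] is [\bot] in [P], applying [psi] gives the same in [Q]. *)
Lemma embed_below_all : (forall x, color_below source_color \bot x) ->
  forall y, color_below target_color \bot y.
Proof.
move=> /(_ (inl \top)) /psi_isotone; rewrite /= psi_top psi_bot => QT y.
exact: le_trans (lex1 _) QT.
Qed.

Definition embed_map :
  lat source_force source_bar (color_below source_color \bot) ->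
  lat target_force target_bar (color_below target_color \bot) :=
  lat_map target_force target_bar (color_below target_color \bot) embed.

Lemma embed_map_bot : embed_map \bot = \bot.
Proof.
exact: lat_map_bot embed_inj embed_force embed_bar embed_below embed_below_all.
Qed.

Lemma embed_map_top : embed_map \top = \top.
Proof. exact: lat_map_top embed_force (frame_incomplete source_frame). Qed.

Lemma embed_map_meet : {morph embed_map : X Y / (X `&` Y)%O}.
Proof.
apply: (lat_map_meet embed_inj embed_force embed_bar).
- exact: below_down target_frame _.
- exact: mem_below_bar target_frame _.
- exact: frame_incomplete source_frame.
Qed.

Lemma embed_map_join : {morph embed_map : X Y / (X `|` Y)%O}.
Proof.
exact: lat_map_join embed_inj embed_force embed_bar embed_below embed_below_all.
Qed.

Lemma embed_map_closure A :
  embed_map (closure _ A) =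
  closure _ [set (embed x.1, x.2) | x in A]%classic.
Proof.
exact: lat_map_closure embed_inj embed_force embed_bar
  embed_below embed_below_all _.
Qed.

End Frames.

Local Close Scope classical_set_scope.

Theorem theorem4 (dP dQ : Order.disp_t) (P : tbPOrderType dP)
    (Q : tbPOrderType dQ) (psi : P -> Q)
    (psi_isotone : {homo psi : x y / x <= y})
    (psi0 : psi \bot = \bot) (psi1 : psi \top = \top) :
  exists (dK dL : Order.disp_t) (K : tbLatticeType dK) (L : tbLatticeType dL)
    (phi : {lmorphism K -> L}),
    [/\ phi \bot = \bot, phi \top = \top &
      exists (mu : P -> Princ K) (nu : Q -> Princ L),
        [/\ order_isomorphism mu, order_isomorphism nu &
            forall x : P, nu (psi x) = Princ_hom phi (mu x)]].
Proof.
have [phi phiE] :=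
  lmorphism_of (embed_map_meet psi_isotone psi1)
               (embed_map_join psi_isotone psi0 psi1).
have FQ := target_frame psi_isotone psi1.
pose mu := frame_map source_force source_bar source_color (@inl P nat).
pose nu := frame_map (target_force psi) target_bar (target_color psi)
  (fun q => inl (inr q)).
exists moore_display, moore_display, _, _, phi; split.
- by rewrite phiE; exact: embed_map_bot.
- by rewrite phiE; exact: embed_map_top.
exists mu, nu; split=> [||p].
- exact: frame_representation source_frame.
- exact: frame_representation FQ.
(* The edge of [psi p] is exchanged for that of [p], which has the same color in the target and is
   the image of the source edge of [p]. *)
rewrite Princ_homE /nu /frame_map (edge_princ_color FQ (j := inl (inl p))) //.
apply: val_inj; rewrite /= !phiE.
by rewrite !embed_map_closure ?image_set1.
Qed.
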